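(* Let $R$ be a principal ideal domain, let $N\in R$ be nonzero and not a unit, let $S=(R/NR)[x_1,\dots,x_n]$, and let $M$ be a finitely generated $S$-module. Then there are an integer $p$ with $0\le p\le n+1$ and free $S$-modules $F_0,\dots,F_p$ of finite rank such that $M$ admits a free $S$-resolution $$\dots\to F_p\to F_p\to F_p\to F_{p-1}\to\dots\to F_1\to F_0\to M\to 0,$$ that is, an exact sequence in which the module in every homological degree $\ge p$ is $F_p$ (the maps may vary). *)

(* Defs.v *)
From HB Require Import structures.
From mathcomp Require Import all_boot all_algebra ring_quotient.
From mathcomp Require Import boolp mpoly.

Set Implicit Arguments.
Unset Strict Implicit.
Unset Printing Implicit Defensive.

Import GRing.Theory.
Local Open Scope ring_scope.

(* Ideals are Prop-valued subsets here: the hypothesis of being a PID is thus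
   about all ideals, not only the decidable ones of ring_quotient. *)
Definition is_ideal (R : comNzRingType) (I : R -> Prop) : Prop :=
  [/\ I 0, forall x y, I x -> I y -> I (x + y) & forall a x, I x -> I (a * x)].

Definition is_pid (R : idomainType) : Prop :=
  forall I : R -> Prop, is_ideal I ->
    exists a : R, forall x, I x <-> exists r, x = r * a.

Definition principal_ideal (R : idomainType) (N : R) : {pred R} :=
  fun x => `[< exists r, x = r * N >].

Lemma principal_ideal_closed (R : idomainType) (N : R) :
  N \isn't a GRing.unit -> idealr_closed (principal_ideal N).
Proof.
move=> NU; split.
- by apply/asboolP; exists 0; rewrite mul0r.
- apply/asboolP => -[r r1]; case/negP: NU.
  by apply/unitrPr; exists r; rewrite mulrC -r1.
- move=> a x y /asboolP[r ->] /asboolP[s ->].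
  by apply/asboolP; exists (a * r + s); rewrite mulrDl mulrA.
Qed.

(* MathComp's commutative rings satisfy 1 != 0, so R / N R is only formed for a
   nonunit N. *)
Section PrincipalQuotient.
Variables (R : idomainType) (N : R) (NU : N \isn't a GRing.unit).

(* The otherwise unused argument NU lets the instance below be found. *)
Definition proper_principal_ideal of N \isn't a GRing.unit : {pred R} :=
  principal_ideal N.

HB.instance Definition _ := isIdealr.Build R (proper_principal_ideal NU)
  (principal_ideal_closed NU).

Definition principal_quotient : comNzRingType :=
  {ideal_quot (proper_principal_ideal NU)}.
End PrincipalQuotient.

Definition finitely_generated (S : nzRingType) (M : lmodType S) : Prop :=
  exists (k : nat) (g : 'I_k -> M), forall x : M,
    exists c : 'I_k -> S, x = \sum_(i < k) c i *: g i.

Definition finite_free (S : nzRingType) (F : lmodType S) : Prop :=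
  exists (k : nat) (b : 'I_k -> F), forall x : F,
    exists! c : {ffun 'I_k -> S}, x = \sum_(i < k) c i *: b i.

Definition exact_at (S : nzRingType) (A B C : lmodType S)
    (f : {linear A -> B}) (g : {linear B -> C}) : Prop :=
  forall y : B, g y = 0 <-> exists x : A, f x = y.

(* ... -> C 2 -> C 1 -> C 0 -> M -> 0 is exact. *)
Definition exact_resolution (S : nzRingType) (M : lmodType S)
    (C : nat -> lmodType S) (d : forall i, {linear C i.+1 -> C i})
    (e : {linear C 0%N -> M}) : Prop :=
  [/\ forall m : M, exists x, e x = m,
      exact_at (d 0%N) e
    & forall i, exact_at (d i.+1) (d i)].

(* Main.v *)
Require Import Defs.
From HB Require Import structures.
From mathcomp Require Import all_boot all_algebra ring_quotient.
From mathcomp Require Import boolp mpoly.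

Set Implicit Arguments.
Unset Strict Implicit.
Unset Printing Implicit Defensive.

Import GRing.Theory.
Local Open Scope ring_scope.

(** Call a ring S good at p ([syzygies_stabilize S p]) if every submodule of a free
module S^q has a free resolution of finite ranks which are constant from degree p
on.

A quotient A of a principal ideal domain is good at 0. All its ideals are
principal, so a submodule of A^q is generated by q elements; the kernel of
A^q -> A^q is again a submodule of A^q, and the construction repeats forever
with the same rank q ([syzygies_stabilize_principal]).

If B is good at p then B[x] is good at p + 1 ([syzygies_stabilize_poly]). Let L
be a submodule of B[x]^m, and let L_d be the B-module of the elements of L of
degree less than d, a submodule of the free B-module B^(d m). The leading
coefficients of L form a submodule of B^m, which is finitely generated because B
is good; as in the basis theorem of Hilbert, L is then generated by L_(d+1) for
some d. With @ for the tensor product over B, the sequence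

        0 -> B[x] @ L_d -> B[x] @ L_(d+1) -> L -> 0

is exact, its first map being v |-> x @ v - 1 @ x v and its second the
evaluation. Both L_d and L_(d+1) have resolutions over B with ranks constant from
degree p on; they stay exact when B[x] is tensored with them, and a mapping cone
of the two resolves L, with ranks constant from degree p + 1 on.

By induction S = A[x_1, ..., x_n] is good at n. A module M with k generators is
S^k / K, and the resolution of K shifted by one degree, preceded by S^k,
resolves M with ranks constant from degree n + 1 on.

The mapping cone is built one syzygy module at a time: a first cover reduces it
to the horseshoe lemma ([resolved_extension]), by which the ranks of resolutions
of a submodule and of the quotient add up. This only ever handles one matrix and
its kernel, so that infinite resolutions are best given coinductively. *)

(** * Infinite free resolutions of submodules of free modules *)

(** The rows of G generate K, and the relations between them are resolved in turn.
The rank sequence is shifted, and not indexed by a degree, so that ranks of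
successive kernels agree by computation and no dimension is ever cast. *)
CoInductive resolved (S : comNzRingType) (s : nat -> nat) (q : nat)
    (K : 'rV[S]_q -> Prop) : Prop :=
  Resolved (G : 'M[S]_(s 0%N, q)) of
    (forall v, K v <-> exists w, v = w *m G)
  & resolved (fun i => s i.+1) (fun w : 'rV_(s 0%N) => w *m G = 0).

Definition submodule (S : comNzRingType) (q : nat) (K : 'rV[S]_q -> Prop) :=
  K 0 /\ forall a u v, K u -> K v -> K (a *: u + v).

Definition syzygies_stabilize (S : comNzRingType) (p : nat) : Prop :=
  forall q (K : 'rV[S]_q -> Prop), submodule K ->
  exists s, (forall i, (p <= i)%N -> s i = s p) /\ resolved s K.

(** Productivity of the corecursive proofs is isolated here: below, resolutions are
obtained from a class X of submodules closed under passing to syzygies. *)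
Lemma resolved_coind (S : comNzRingType)
    (X : (nat -> nat) -> forall q, ('rV[S]_q -> Prop) -> Prop) :
    (forall s q (K : 'rV[S]_q -> Prop), X s q K ->
       exists G : 'M[S]_(s 0%N, q),
         (forall v, K v <-> exists w, v = w *m G)
         /\ X (fun i => s i.+1) _ (fun w : 'rV_(s 0%N) => w *m G = 0)) ->
  forall s q (K : 'rV[S]_q -> Prop), X s q K -> resolved s K.
Proof.
move=> stepX; cofix IH => s q K /stepX[G [KG XG]].
exact: (@Resolved S s q K G KG (IH _ _ _ XG)).
Qed.

Section Submodule.
Variables (S : comNzRingType) (q : nat) (K : 'rV[S]_q -> Prop).
Hypothesis subK : submodule K.

Lemma submodule0 : K 0. Proof. by case: subK. Qed.

Lemma submoduleZ a u : K u -> K (a *: u).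
Proof. by case: subK => K0 KL Ku; rewrite -[_ *: u]addr0; apply: KL. Qed.

Lemma submoduleD u v : K u -> K v -> K (u + v).
Proof. by case: subK => K0 KL Ku Kv; rewrite -[u]scale1r; apply: KL. Qed.

Lemma submoduleB u v : K u -> K v -> K (u - v).
Proof. by move=> Ku Kv; rewrite -scaleN1r addrC; case: subK => _; apply. Qed.

Lemma submodule_sum (I : Type) (r : seq I) (P : pred I) (F : I -> 'rV[S]_q) :
  (forall i, P i -> K (F i)) -> K (\sum_(i <- r | P i) F i).
Proof.
move=> KF; elim/big_ind: _ => // [|u v]; [exact: submodule0|exact: submoduleD].
Qed.

Lemma submodule_mulmx m (G : 'M[S]_(m, q)) (w : 'rV_m) :
  (forall i, K (row i G)) -> K (w *m G).
Proof.
by move=> KG; rewrite mulmx_sum_row; apply: submodule_sum => i _;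
  apply: submoduleZ.
Qed.

Lemma submodule_kermx m (G : 'M[S]_(q, m)) :
  submodule (fun w : 'rV[S]_q => w *m G = 0).
Proof.
split=> [|a u v u0 v0]; first exact: mul0mx.
by rewrite mulmxDl -scalemxAl u0 v0 scaler0 addr0.
Qed.
End Submodule.

Lemma exists_row_matrix (T : Type) (m q : nat) (P : 'I_m -> 'rV[T]_q -> Prop) :
  (forall i, exists v, P i v) -> exists G : 'M[T]_(m, q), forall i, P i (row i G).
Proof.
move=> /choice[f Pf]; exists (\matrix_i f i) => i.
by rewrite rowK.
Qed.

Lemma resolved_iff (S : comNzRingType) s q (K K' : 'rV[S]_q -> Prop) :
  (forall v, K v <-> K' v) -> resolved s K -> resolved s K'.
Proof. by move=> KK' [G KG resG]; exists G => // v; rewrite -KK'. Qed.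

Lemma resolved_image (S : comNzRingType) s q q' (J : 'M[S]_(q, q'))
    (K : 'rV[S]_q -> Prop) :
    (forall v, K v -> v *m J = 0 -> v = 0) ->
  resolved s K -> resolved s (fun u => exists v, K v /\ u = v *m J).
Proof.
move=> injJ [G KG resG]; exists (G *m J) => [u|].
  split=> [[v [/KG[w ->] ->]]|[w ->]]; first by exists w; rewrite mulmxA.
  by exists (w *m G); rewrite mulmxA; split=> //; apply/KG; exists w.
apply: resolved_iff resG => w; rewrite mulmxA; split=> [->|]; first exact: mul0mx.
by apply: injJ; apply/KG; exists w.
Qed.

(** The horseshoe lemma, for the submodule of E killed by J and its quotient, the
image of E. Generators of the submodule together with lifts of generators of the
image generate E, and the relations between them form a module of the same
shape: those which only involve the first kind are the relations of the
submodule, and projecting on the second kind gives the relations of the image. *)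
Lemma resolved_extension (S : comNzRingType) (sA sC : nat -> nat) q q'
    (J : 'M[S]_(q, q')) (E : 'rV[S]_q -> Prop) :
    submodule E ->
    resolved sA (fun v => E v /\ v *m J = 0) ->
    resolved sC (fun u => exists v, E v /\ u = v *m J) ->
  resolved (fun i => sA i + sC i)%N E.
Proof.
move=> subE resA resC; apply: (@resolved_coind S (fun s q (E : 'rV_q -> Prop) =>
  exists sA sC q' (J : 'M_(q, q')), [/\ s = (fun i => sA i + sC i)%N, submodule E,
    resolved sA (fun v => E v /\ v *m J = 0) &
    resolved sC (fun u => exists v, E v /\ u = v *m J)])); last first.
  by exists sA, sC, q', J.
move=> {sA sC q q' J E subE resA resC} _ q E
  [sA [sC [q' [J [-> subE [GA AG resA] [GC CG resC]]]]]].
(* the rows of GE lift the rows of GC to E *)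
have /exists_row_matrix[GE GEC] i : exists v, E v /\ row i GC = v *m J.
  by apply/CG; exists (delta_mx 0 i); rewrite rowE.
have EGE i : E (row i GE) by case: (GEC i).
have GEJ : GE *m J = GC.
  by apply/row_matrixP => i; rewrite row_mul; case: (GEC i).
have AGA w : E (w *m GA) /\ w *m GA *m J = 0 by apply/AG; exists w.
exists (col_mx GA GE); split=> [v|].
  split=> [Ev|[w ->]].
    have /CG[wC vJ] : exists v', E v' /\ v *m J = v' *m J by exists v.
    have /AG[wA vA] : E (v - wC *m GE) /\ (v - wC *m GE) *m J = 0.
      split; last by rewrite mulmxBl -mulmxA GEJ vJ subrr.
      by apply: submoduleB => //; apply: submodule_mulmx.
    by exists (row_mx wA wC); rewrite mul_row_col -vA subrK.
  rewrite -[w]hsubmxK mul_row_col; apply: submoduleD => //.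
    by case: (AGA (lsubmx w)).
  exact: submodule_mulmx.
(* the projection of S^(a + c) on S^c *)
exists (fun i => sA i.+1), (fun i => sC i.+1), _, (col_mx 0 1%:M).
split=> //; first exact: submodule_kermx.
  apply: resolved_iff (resolved_image (J := row_mx 1%:M 0) _ resA) => [w|w _].
    split=> [[v [v0 ->]]|].
      rewrite mul_mx_row mulmx1 mulmx0 !mul_row_col v0.
      by rewrite !mul0mx !mulmx0 !addr0.
    rewrite -[w]hsubmxK !mul_row_col mulmx0 mulmx1 add0r => -[+ w0].
    rewrite w0 mul0mx addr0 => w1; exists (lsubmx w).
    by rewrite mul_mx_row mulmx1 mulmx0.
  by rewrite mul_mx_row mulmx1 => /(congr1 lsubmx); rewrite row_mxKl linear0.
apply: resolved_iff resC => w; split=> [w0|[v [+ ->]]].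
  have /AG[wA wE] : E (w *m GE) /\ w *m GE *m J = 0.
    by rewrite -mulmxA GEJ; split=> //; apply: submodule_mulmx.
  exists (row_mx (- wA) w); rewrite !mul_row_col mulmx0 mulmx1 add0r.
  by rewrite mulNmx -wE addNr.
rewrite -[v]hsubmxK !mul_row_col mulmx0 mulmx1 add0r => /(congr1 (mulmx^~ J)).
rewrite mulmxDl (AGA _).2 add0r mul0mx => <-.
by rewrite -mulmxA GEJ.
Qed.

(** The mapping cone of 0 -> A -> E -> C -> 0. A cover S^r -> E also covers C, and
its kernel over C is an extension of A by the kernel over E, to which the
horseshoe lemma applies. *)
Lemma resolved_cokernel (S : comNzRingType) (sA sE : nat -> nat) qA qE qC
    (J : 'M[S]_(qA, qE)) (F : 'M[S]_(qE, qC))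
    (A : 'rV[S]_qA -> Prop) (E : 'rV[S]_qE -> Prop) :
    (forall a, A a -> a *m J = 0 -> a = 0) ->
    (forall e, E e /\ e *m F = 0 <-> exists a, A a /\ e = a *m J) ->
    resolved sA A -> resolved sE E ->
  resolved (fun i => if i is j.+1 then sA j + sE j.+1 else sE 0)%N
    (fun c => exists e, E e /\ c = e *m F).
Proof.
move=> injJ exJF resA [G EG resG]; set s := fun i => _.
apply: (@Resolved S s _ _ (G *m F)) => [c|].
  split=> [[e [/EG[w ->] ->]]|[w ->]]; first by exists w; rewrite mulmxA.
  by exists (w *m G); rewrite mulmxA; split=> //; apply/EG; exists w.
have -> : (fun i => s i.+1) = (fun i => sE i.+1 + sA i)%N.
  by apply/funext => i; rewrite addnC.
apply: (@resolved_extension _ _ _ _ _ G); first exact: submodule_kermx.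
  by apply: resolved_iff resG => w; rewrite mulmxA;
    split=> [w0|[]//]; rewrite w0 mul0mx.
apply: resolved_iff (resolved_image injJ resA) => u; rewrite -exJF EG.
by split=> [[[w ->] w0]|[w [w0 ->]]]; [exists w|split; [exists w|]];
  rewrite ?mulmxA // -mulmxA.
Qed.

(** * Extension of resolutions from B to B[x] *)

Local Notation coefmx k := (map_mx (coefp k)).

Section CoefficientRows.
Variables (B : comNzRingType) (q : nat).
Implicit Types (u v : 'rV[{poly B}]_q) (K : 'rV[B]_q -> Prop).

Lemma coefmx_inj u v : (forall k, coefmx k u = coefmx k v) -> u = v.
Proof.
move=> uv; apply/rowP => j; apply/polyP => k.
by have /rowP/(_ j) := uv k; rewrite !mxE.
Qed.

Lemma coefmx_bound v : exists N, forall k, (N <= k)%N -> coefmx k v = 0.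
Proof.
exists (\max_j size (v 0%R j)) => k Nk; apply/rowP => j; rewrite !mxE /=.
by apply/nth_default/(leq_trans _ Nk)/leq_bigmax.
Qed.

Lemma exists_coefmx (f : nat -> 'rV[B]_q) N :
  (forall k, (N <= k)%N -> f k = 0) -> exists v, forall k, coefmx k v = f k.
Proof.
move=> fN; exists (\row_j \poly_(k < N) f k 0 j) => k.
apply/rowP => j; rewrite !mxE /= coef_poly.
by case: ltnP => // /fN ->; rewrite mxE.
Qed.

Lemma coefmxZ k (a : {poly B}) v :
  coefmx k (a *: v) = \sum_(j < k.+1) a`_j *: coefmx (k - j)%N v.
Proof.
apply/rowP => i; rewrite summxE !mxE /= coefM.
by apply: eq_bigr => j _; rewrite !mxE.
Qed.

Lemma coefmxXnZ k n v :
  coefmx k ('X^n *: v) = if (k < n)%N then 0 else coefmx (k - n)%N v.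
Proof.
by apply/rowP => i; rewrite !mxE /= coefXnM; case: ifP; rewrite mxE.
Qed.

Lemma coefmxXZ k v :
  coefmx k ('X *: v) = if k is j.+1 then coefmx j v else 0.
Proof.
by rewrite -['X]expr1 coefmxXnZ; case: k => // k; rewrite subn1.
Qed.

Lemma coefmxC k (w : 'rV[B]_q) :
  coefmx k (map_mx polyC w) = if k is 0 then w else 0.
Proof. by apply/rowP => i; case: k => [|k]; rewrite !mxE /= coefC. Qed.

Lemma coefmx_expand v : exists N,
  v = \sum_(k < N) 'X^k *: map_mx polyC (coefmx k v).
Proof.
have [N vN] := coefmx_bound v; exists N.
apply/rowP => j; apply/polyP => k.
rewrite summxE coef_sum.
have [Nk|kN] := leqP N k.
  have /rowP/(_ j) := vN k Nk; rewrite !mxE /= => ->; rewrite big1 // => i _.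
  have ik := leq_trans (ltn_ord i) Nk.
  by rewrite !mxE coefXnM coefC subn_eq0 [(k <= i)%N]leqNgt ik if_same.
rewrite (bigD1 (Ordinal kN)) //= big1 ?addr0 => [|i ik].
  by rewrite !mxE coefXnM ltnn subnn coefC.
rewrite !mxE coefXnM coefC subn_eq0; case: ltngtP => // ki.
by case/eqP: ik; apply/val_inj.
Qed.

Lemma submodule_poly K : submodule K ->
  submodule (fun v => forall k, K (coefmx k v)).
Proof.
move=> subK; split=> [k|a u v Ku Kv k].
  by rewrite map_mx0; apply: submodule0.
rewrite map_mxD coefmxZ; apply: submoduleD; [by []| |exact: Kv].
by apply: submodule_sum => // j _; apply: submoduleZ.
Qed.
End CoefficientRows.

Lemma coefmx_mulC (B : comNzRingType) k q m (w : 'rV[{poly B}]_q) (G : 'M_(q, m)) :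
  coefmx k (w *m map_mx polyC G) = coefmx k w *m G.
Proof.
apply/rowP => i; rewrite !mxE /= coef_sum.
by apply: eq_bigr => j _; rewrite !mxE coefMC.
Qed.

(** Base change along B -> B[x]. Inside B[x]^q the module B[x] @ K consists of the
vectors all of whose coefficients are in K, and a matrix over B acts on the
coefficients of each power of x separately. *)
Lemma resolved_poly (B : comNzRingType) s q (K : 'rV[B]_q -> Prop) :
  resolved s K ->
  resolved s (fun v : 'rV[{poly B}]_q => forall k, K (coefmx k v)).
Proof.
move=> resK; apply: (@resolved_coind {poly B} (fun s q (Kx : 'rV_q -> Prop) =>
  exists2 K : 'rV[B]_q -> Prop, resolved s K
    & forall v, Kx v <-> forall k, K (coefmx k v))); last by exists K.
move=> {s q K resK} s q Kx [K [G KG resG] KxE].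
exists (map_mx polyC G); split=> [v|].
  rewrite KxE.
  split=> [Kv|[w ->] k]; last first.
    by apply/KG; exists (coefmx k w); rewrite coefmx_mulC.
  (* the chosen preimages must vanish in high degrees to make a polynomial *)
  have [N vN] := coefmx_bound v.
  have /choice[f fG] k : exists w,
      coefmx k v = w *m G /\ ((N <= k)%N -> w = 0).
    have /KG[w vw] := Kv k; have [Nk|_] := leqP N k; last by exists w.
    by exists 0; rewrite vN // mul0mx.
  have [w wf] : exists w, forall k, coefmx k w = f k.
    by apply: (exists_coefmx (N := N)) => k; case: (fG k).
  exists w; apply: coefmx_inj => k; rewrite coefmx_mulC wf.
  by case: (fG k).
exists (fun w => w *m G = 0) => // w.
split=> [w0 k|w0]; first by rewrite -coefmx_mulC w0 raddf0.
by apply: coefmx_inj => k; rewrite coefmx_mulC w0 raddf0.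
Qed.

Lemma mul_rV_linear (S : comNzRingType) m n (f : 'rV[S]_m -> 'rV_n) u :
  linear f -> u *m lin1_mx f = f u.
Proof.
move=> lin_f; pose fl : {linear 'rV_m -> 'rV_n} :=
  HB.pack f (GRing.isLinear.Build S 'rV_m 'rV_n *:%R f lin_f).
exact: (mul_rV_lin1 fl).
Qed.

(** * Vectors cut into blocks *)

(** A vector of length d * m stands for a polynomial of degree less than d with
coefficients in T^m. Blocks are indexed by all natural numbers and vanish from d
on, which spares the boundary cases of sums and shifts. *)
Section Blocks.
Variables (T : comNzRingType) (m d : nat).
Implicit Types (u v : 'rV[T]_(d * m)) (f : nat -> 'rV[T]_m).

Definition block u (i : nat) : 'rV[T]_m :=
  if insub i is Some j then row j (vec_mx u) else 0.

Definition of_blocks f : 'rV[T]_(d * m) := mxvec (\matrix_(i < d) f i).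

Lemma block_ge u i : (d <= i)%N -> block u i = 0.
Proof. by move=> di; rewrite /block insubF // ltnNge di. Qed.

Lemma of_blocksK f i : block (of_blocks f) i = if (i < d)%N then f i else 0.
Proof.
case: ltnP => [id|/block_ge//].
by rewrite /block insubT mxvecK rowK.
Qed.

Lemma block_inj u v : (forall i, block u i = block v i) -> u = v.
Proof.
move=> uv; rewrite -[u]vec_mxK -[v]vec_mxK; congr mxvec.
by apply/row_matrixP => i; have := uv i; rewrite /block valK.
Qed.

Lemma block_linear i : linear (block^~ i).
Proof.
move=> a u v /=; rewrite /block; case: insub => [j|]; first by rewrite !linearP.
by rewrite scaler0 addr0.
Qed.

Lemma block0 i : block 0 i = 0.
Proof. by rewrite /block; case: insub => // j; rewrite !linear0. Qed.
End Blocks.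

Lemma map_block (T T' : comNzRingType) (g : {additive T -> T'}) m d
    (u : 'rV[T]_(d * m)) i :
  block (map_mx g u) i = map_mx g (block u i).
Proof.
rewrite /block; case: insub => [j|]; last by rewrite raddf0.
by rewrite -map_vec_mx map_row.
Qed.

(** * Submodules of B[x]^m through their elements of low degree *)

Section PolynomialStep.
Variables (B : comNzRingType) (m : nat).
Implicit Types (L : 'rV[{poly B}]_m -> Prop).

(** The B[x]-linear extension of the inclusion of the vectors of degree less than d
in B[x]^m; its argument is in B[x] @ B^(d m), which is why the blocks are
themselves polynomial. *)
Definition eval_blocks d (u : 'rV[{poly B}]_(d * m)) : 'rV[{poly B}]_m :=
  \sum_(i < d) 'X^i *: block u i.

(** The map v |-> x @ v - 1 @ x v from B[x] @ B^(d m) to B[x] @ B^((d + 1) m). *)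
Definition shift_blocks d (v : 'rV[{poly B}]_(d * m)) :
    'rV[{poly B}]_(d.+1 * m) :=
  of_blocks d.+1 (fun i => 'X *: block v i - (if i is j.+1 then block v j else 0)).

Lemma eval_blocks_linear d : linear (@eval_blocks d).
Proof.
move=> a u v; rewrite /eval_blocks scaler_sumr -big_split /=.
by apply: eq_bigr => i _; rewrite block_linear scalerDr !scalerA mulrC.
Qed.

Lemma block_shift d (v : 'rV_(d * m)) i :
  block (shift_blocks v) i =
    'X *: block v i - (if i is j.+1 then block v j else 0).
Proof.
rewrite of_blocksK; case: ltnP => // di.
rewrite block_ge ?scaler0 ?sub0r 1?ltnW //.
by case: i di => // i di; rewrite block_ge // oppr0.
Qed.

Lemma shift_blocks_linear d : linear (@shift_blocks d).
Proof.
move=> a u v; apply: block_inj => i; rewrite block_linear !block_shift.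
rewrite !block_linear scalerDr scalerBr addrACA -opprD !scalerA mulrC.
congr (_ - _); case: i => [|i]; first by rewrite scaler0 addr0.
by rewrite block_linear.
Qed.

(** The top block of the image is minus the top block of v, so the blocks of v are
recovered from the top down. *)
Lemma shift_blocks_inj d (v : 'rV_(d * m)) : shift_blocks v = 0 -> v = 0.
Proof.
move=> v0; apply: block_inj => i; rewrite block0.
have: (d <= i + d)%N by rewrite leq_addl.
elim: {2}d i => [|n IHn] i di; first by rewrite block_ge // -[i]addn0.
have := congr1 ((@block _ _ _)^~ i.+1) v0.
rewrite block_shift block0 IHn ?addSnnS // scaler0 sub0r.
by move/eqP; rewrite oppr_eq0 => /eqP.
Qed.

Lemma eval_shift_blocks d (v : 'rV_(d * m)) : eval_blocks (shift_blocks v) = 0.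
Proof.
rewrite /eval_blocks; under eq_bigr do rewrite block_shift scalerBr scalerA -exprSr.
rewrite sumrB big_ord_recr /= block_ge // scaler0 addr0.
by rewrite big_ord_recl /= scaler0 add0r subrr.
Qed.

(** With the blocks as the coefficients of a polynomial in a new variable y, the
shift is multiplication by x - y and the evaluation is the substitution of x for
y. So this is the factor theorem, and h is the quotient by x - y, whose
coefficients are found from the top down. *)
Lemma eval_blocks_eq0 d (u : 'rV_(d.+1 * m)) :
  eval_blocks u = 0 -> exists v : 'rV_(d * m), u = shift_blocks v.
Proof.
move=> u0; pose h i := - \sum_(k < d - i) 'X^k *: block u (i.+1 + k).
have h_ge i : (d <= i)%N -> h i = 0.
  by rewrite -subn_eq0 /h => /eqP ->; rewrite big_ord0 oppr0.
have hS i : 'X *: h i.+1 - h i = block u i.+1.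
  have [di|id] := leqP d i.
    by rewrite !h_ge ?(leqW di) // scaler0 subr0 block_ge.
  have -> : h i = 'X *: h i.+1 - block u i.+1; last by rewrite subKr.
  rewrite /h -(subnSK id) big_ord_recl expr0 scale1r addn0 opprD addrC.
  rewrite scalerN scaler_sumr; congr (- _ - _); apply: eq_bigr => k _.
  by rewrite lift0 scalerA -exprS addnS.
have h0 : 'X *: h 0 = block u 0.
  move: u0; rewrite /eval_blocks big_ord_recl expr0 scale1r => /eqP.
  rewrite addr_eq0 => /eqP ->; rewrite /h subn0 scalerN scaler_sumr.
  by congr (- _); apply: eq_bigr => k _; rewrite scalerA -exprS.
have hv i : block (of_blocks d h) i = h i.
  by rewrite of_blocksK; case: ltnP => // di; rewrite h_ge.
exists (of_blocks d h); apply: block_inj => -[|i]; rewrite block_shift !hv //.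
by rewrite subr0 h0.
Qed.

(** The elements of L of degree less than d, as a submodule of B^(d m). *)
Definition low_part L d (c : 'rV[B]_(d * m)) := L (eval_blocks (map_mx polyC c)).

Lemma low_part_submodule L d : submodule L -> submodule (@low_part L d).
Proof.
move=> subL; split=> [|a u v Lu Lv]; rewrite /low_part.
  rewrite raddf0 (_ : eval_blocks 0 = 0); first exact: submodule0.
  by rewrite /eval_blocks big1 // => i _; rewrite block0 scaler0.
rewrite map_mxD map_mxZ eval_blocks_linear.
by case: subL => _; apply.
Qed.

(** The coefficient of degree k is the one of degree k - 1 in v, because of x @ v,
minus x times the one of degree k in v, because of 1 @ x v. *)
Lemma eval_coefmx_shift d (v : 'rV_(d * m)) k :
  eval_blocks (map_mx polyC (coefmx k (shift_blocks v))) =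
    (if k is j.+1 then eval_blocks (map_mx polyC (coefmx j v)) else 0)
    - 'X *: eval_blocks (map_mx polyC (coefmx k v)).
Proof.
rewrite /eval_blocks.
under eq_bigr do rewrite !map_block block_shift !map_mxB scalerBr.
rewrite sumrB; congr (_ - _).
  case: k => [|k].
    by rewrite big1 // => i _; rewrite coefmxXZ map_mx0 scaler0.
  under eq_bigr do rewrite coefmxXZ.
  rewrite big_ord_recr block_ge // !map_mx0 scaler0 /= addr0.
  by apply: eq_bigr => i _; rewrite map_block (map_block (coefp k)).
rewrite big_ord_recl !map_mx0 scaler0 /= add0r scaler_sumr.
by apply: eq_bigr => i _; rewrite map_block (map_block (coefp k)) scalerA -exprS.
Qed.

(** Exactness in the middle comes down to this. When the shift of v has its
coefficients in L, [eval_coefmx_shift] expresses each coefficient of v, modulo L,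
as x times the next one, and the high ones are zero. *)
Lemma shift_low_part L d (v : 'rV_(d * m)) : submodule L ->
  (forall k, low_part L (coefmx k (shift_blocks v)))
    <-> (forall k, low_part L (coefmx k v)).
Proof.
move=> subL; split=> Lv k.
  have [N vN] := coefmx_bound v.
  have: (N <= k + N)%N by rewrite leq_addl.
  elim: {2}N k => [|n IHn] k; rewrite ?addn0 => Nk.
    by rewrite vN //; exact: (submodule0 (low_part_submodule d subL)).
  have := Lv k.+1; rewrite /low_part eval_coefmx_shift /= => Lk.
  rewrite -[eval_blocks _](subrK ('X *: eval_blocks (map_mx polyC (coefmx k.+1 v)))).
  apply: submoduleD => //; apply: submoduleZ => //.
  by apply: IHn; rewrite addSnnS.
rewrite /low_part eval_coefmx_shift; apply: submoduleB => //; last first.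
  by apply: submoduleZ => //; apply: Lv.
by case: k => [|k]; [apply: submodule0|apply: Lv].
Qed.

Lemma eval_low_part L d (u : 'rV_(d * m)) : submodule L ->
  (forall k, low_part L (coefmx k u)) -> L (eval_blocks u).
Proof.
move=> subL Lu; have [N ->] := coefmx_expand u.
rewrite -(@mul_rV_linear _ _ _ (@eval_blocks d)); last exact: eval_blocks_linear.
rewrite mulmx_suml; apply: submodule_sum => // k _.
rewrite -scalemxAl mul_rV_linear; last exact: eval_blocks_linear.
by apply: submoduleZ => //; apply: Lu.
Qed.

Lemma low_degree L d v : L v -> (forall k, (d <= k)%N -> coefmx k v = 0) ->
  exists c : 'rV[B]_(d * m), low_part L c /\ v = eval_blocks (map_mx polyC c).
Proof.
move=> Lv vd; pose c := of_blocks d (fun i => coefmx i v).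
suff vE : v = eval_blocks (map_mx polyC c).
  by exists c; split=> //; rewrite /low_part -vE.
apply: coefmx_inj => k; rewrite raddf_sum /=.
under eq_bigr => i _ do
  rewrite map_block of_blocksK ltn_ord coefmxXnZ coefmxC.
have [dk|kd] := leqP d k.
  rewrite vd // big1 // => i _.
  have ik := leq_trans (ltn_ord i) dk.
  by rewrite ltnNge (ltnW ik) /=; move: ik; rewrite -subn_gt0; case: subn.
rewrite (bigD1 (Ordinal kd)) //= ltnn subnn big1 ?addr0 // => i ik.
case: ltngtP => // [{}ik|ki]; first by move: ik; rewrite -subn_gt0; case: subn.
by case/eqP: ik; apply/val_inj; rewrite ?ki.
Qed.

(** The argument of the basis theorem of Hilbert: the leading coefficients of L
form a finitely generated submodule of B^m, and d is a degree in which all of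
them already occur. *)
Lemma generated_in_low_degree L p : syzygies_stabilize B p -> submodule L ->
  exists d, forall v, L v <->
    exists u : 'rV_(d.+1 * m),
      (forall k, low_part L (coefmx k u)) /\ v = eval_blocks u.
Proof.
move=> stabB subL.
pose U d c := exists v, [/\ L v, coefmx d v = c
  & forall k, (d < k)%N -> coefmx k v = 0].
have subU d : submodule (U d).
  split=> [|a u v [u' [Lu <- ud]] [v' [Lv <- vd]]].
    by exists 0; split=> [||k _]; rewrite ?raddf0 //; apply: submodule0.
  have coefZ k : coefmx k (a%:P *: u' + v') = a *: coefmx k u' + coefmx k v'.
    by apply/rowP => j; rewrite !mxE /= coefD coefCM.
  exists (a%:P *: u' + v'); split=> [||k dk]; rewrite ?coefZ //.
    by case: subL => _; apply.
  by rewrite ud ?vd // scaler0 addr0.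
(* multiplication by X^(e - d) *)
have leU d e c : (d <= e)%N -> U d c -> U e c.
  move=> de [v [Lv <- vd]]; exists ('X^(e - d) *: v); split=> [||k ek].
  - exact: submoduleZ.
  - by rewrite coefmxXnZ ltnNge leq_subr subKn.
  - rewrite coefmxXnZ; case: ifP => // _; apply: vd.
    by rewrite ltn_subRL addnC subnKC.
have [|s [_ [G UG _]]] := stabB m (fun c => exists d, U d c).
  split=> [|a u v [d Uu] [e Uv]]; first by exists 0; apply: submodule0.
  exists (maxn d e); apply: (subU _).2; [apply: leU Uu|apply: leU Uv];
    by rewrite ?leq_maxl ?leq_maxr.
have /choice[f fU] i : exists d, U d (row i G).
  by apply/UG; exists (delta_mx 0 i); rewrite rowE.
pose d := \max_i f i; have Ud e c : U e c -> U d c.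
  move=> Uc; have /UG[w ->] : exists e, U e c by exists e.
  by apply: submodule_mulmx => // i; apply: leU (fU i); apply: leq_bigmax.
exists d => v; split=> [|[u [Lu ->]]]; last exact: eval_low_part.
have subE := submodule_poly (low_part_submodule d.+1 subL).
have low v' : L v' -> (forall k, (d < k)%N -> coefmx k v' = 0) ->
    exists u : 'rV_(d.+1 * m),
      (forall k, low_part L (coefmx k u)) /\ v' = eval_blocks u.
  move=> Lv' /(low_degree Lv')[c [Lc ->]]; exists (map_mx polyC c); split=> // k.
  rewrite coefmxC; case: k => // k.
  exact: (submodule0 (low_part_submodule d.+1 subL)).
have [N] := coefmx_bound v; elim: N v => [|N IHN] v vN Lv.
  by apply: low => // k _; apply: vN.
have [Nd|dN] := leqP N d.
  by apply: low => // k dk; apply/vN/(leq_ltn_trans Nd).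
have [v0 [Lv0 v0d v0gt]] : U d (coefmx N v) by apply: (Ud N); exists v.
have [u0 [Lu0 v0E]] := low v0 Lv0 v0gt.
(* cancel the coefficient of degree N of v *)
have [||u [Lu vE]] := IHN (v - 'X^(N - d) *: v0).
- move=> k; rewrite leq_eqVlt raddfB /= coefmxXnZ => /predU1P[<-|Nk].
    by rewrite ltnNge leq_subr /= subKn ?v0d ?subrr // ltnW.
  rewrite vN // v0gt ?if_same ?subr0 //.
  by rewrite ltn_subRL addnC subnKC // ltnW.
- by apply: submoduleB => //; apply: submoduleZ.
exists ('X^(N - d) *: u0 + u); split; first by case: subE => _; apply.
by rewrite eval_blocks_linear -vE -v0E addrC subrK.
Qed.
End PolynomialStep.

Lemma syzygies_stabilize_poly (B : comNzRingType) p :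
  syzygies_stabilize B p -> syzygies_stabilize {poly B} p.+1.
Proof.
move=> stabB m L subL.
have [d LE] := generated_in_low_degree stabB subL.
have [sA [sAp resA]] := stabB _ _ (low_part_submodule d subL).
have [sE [sEp resE]] := stabB _ _ (low_part_submodule d.+1 subL).
exists (fun i => if i is j.+1 then sA j + sE j.+1 else sE 0)%N; split.
  by case=> // i pi; rewrite sAp // !sEp // ltnW.
apply: resolved_iff; last apply: (resolved_cokernel
  (J := lin1_mx (@shift_blocks B m d)) (F := lin1_mx (@eval_blocks B m d.+1))
  _ _ (resolved_poly resA) (resolved_poly resE)).
- move=> v; rewrite LE; split=> -[u [Lu ->]]; exists u; split=> //;
    by rewrite mul_rV_linear //; apply: eval_blocks_linear.
- by move=> a _; rewrite mul_rV_linear;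
    [apply: shift_blocks_inj|apply: shift_blocks_linear].
move=> e; rewrite mul_rV_linear; last exact: eval_blocks_linear.
split=> [[Le /eval_blocks_eq0[v ev]]|[v [Lv ->]]].
  exists v; rewrite mul_rV_linear; last exact: shift_blocks_linear.
  by split=> //; apply/shift_low_part; rewrite -?ev.
rewrite mul_rV_linear; last exact: shift_blocks_linear.
by split; [apply/shift_low_part|apply: eval_shift_blocks].
Qed.

(** * From quotients of principal ideal domains to polynomial rings over them *)

Lemma syzygies_stabilize_iso (B B' : comNzRingType) (f : {rmorphism B -> B'})
    (g : B' -> B) p :
  cancel f g -> cancel g f -> syzygies_stabilize B p -> syzygies_stabilize B' p.
Proof.
move=> fK gK stabB q K subK.
have mapfK m n : cancel (@map_mx _ _ f m n) (map_mx g).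
  by move=> v; apply/matrixP => i j; rewrite !mxE fK.
have mapgK m n : cancel (@map_mx _ _ g m n) (map_mx f).
  by move=> v; apply/matrixP => i j; rewrite !mxE gK.
have [|s [sp resK]] := stabB q (fun v => K (map_mx f v)).
  split=> [|a u v Ku Kv]; first by rewrite map_mx0; apply: submodule0.
  by rewrite map_mxD map_mxZ; case: subK => _; apply.
exists s; split=> //.
apply: (@resolved_coind B' (fun s q (K : 'rV_q -> Prop) =>
  resolved s (fun v : 'rV[B]_q => K (map_mx f v)))); last exact: resK.
move=> {s q K subK sp resK} s q K [G KG resG]; exists (map_mx f G); split=> [v|].
  rewrite -[v]mapgK KG; split=> -[w wG].
    by exists (map_mx f w); rewrite wG map_mxM.
  exists (map_mx g w); apply: (can_inj (mapfK _ _)).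
  by rewrite map_mxM (mapgK _ _ w).
apply: resolved_iff resG => w; rewrite -map_mxM.
split=> [->|wG0]; first exact: map_mx0.
by apply: (can_inj (mapfK _ _)); rewrite wG0 map_mx0.
Qed.

(** The first coordinates of the elements of K form a principal ideal; an element
of K whose first coordinate generates it, with q generators of the elements of
K that have first coordinate 0, generate K. *)
Lemma square_generators (A : comNzRingType)
    (principalA : forall I : A -> Prop, is_ideal I ->
       exists a, forall x, I x <-> exists r, x = r * a)
    q (K : 'rV[A]_q -> Prop) :
  submodule K -> exists G : 'M[A]_q, forall v, K v <-> exists w, v = w *m G.
Proof.
elim: q K => [|q IHq] K subK.
  exists 0 => v; rewrite [v]thinmx0; split=> _; last exact: submodule0.
  by exists 0; rewrite mul0mx.
rewrite -[q.+1]/(1 + q)%N in K subK *.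
have [|a Ia] := principalA (fun x => exists v : 'rV_q, K (row_mx x%:M v)).
  split=> [|x y [u Ku] [v Kv]|r x [u Ku]].
  - by exists 0; rewrite raddf0 row_mx0; apply: submodule0.
  - by exists (u + v); rewrite raddfD -add_row_mx; apply: submoduleD.
  - by exists (r *: u); rewrite -scale_scalar_mx -scale_row_mx; apply: submoduleZ.
have [u Ku] : exists v, K (row_mx a%:M v) by apply/Ia; exists 1; rewrite mul1r.
have [|G KG] := IHq (fun v => K (row_mx 0 v)).
  split=> [|r v w Kv Kw]; first by rewrite row_mx0; apply: submodule0.
  have -> : row_mx 0 (r *: v + w) = r *: row_mx 0 v + row_mx 0 w :> 'rV_(1 + q).
    by rewrite scale_row_mx add_row_mx scaler0 addr0.
  by case: subK => _; apply.
exists (block_mx a%:M u 0 G) => v.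
have combE (r : A) (w : 'rV_q) :
    row_mx r%:M w *m block_mx a%:M u 0 G = r *: row_mx a%:M u + row_mx 0 (w *m G).
  by rewrite mul_row_block mulmx0 addr0 !mul_scalar_mx scale_row_mx add_row_mx addr0.
split=> [|[w ->]]; last first.
  rewrite -[w]hsubmxK [lsubmx w]mx11_scalar combE; apply: submoduleD => //.
    exact: submoduleZ.
  by apply/KG; exists (rsubmx w).
rewrite -[v]hsubmxK [lsubmx v]mx11_scalar; move: (lsubmx v 0 0) (rsubmx v) => x y Kv.
have [r xE] : exists r, x = r * a by apply/Ia; exists y.
have /KG[w wE] : K (row_mx 0 (y - r *: u)).
  have := submoduleB subK Kv (submoduleZ subK r Ku).
  by rewrite scale_row_mx scale_scalar_mx -xE opp_row_mx add_row_mx subrr.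
exists (row_mx r%:M w).
by rewrite combE -wE scale_row_mx add_row_mx addr0 scale_scalar_mx -xE addrC subrK.
Qed.

Lemma syzygies_stabilize_principal (A : comNzRingType)
    (principalA : forall I : A -> Prop, is_ideal I ->
       exists a, forall x, I x <-> exists r, x = r * a) :
  syzygies_stabilize A 0.
Proof.
move=> q K subK; exists (fun=> q); split=> //.
apply: (@resolved_coind A (fun s q' (K : 'rV_q' -> Prop) =>
  submodule K /\ s = (fun=> q'))); last by [].
move=> {q K subK} _ q K [subK ->]; have [G KG] := square_generators principalA subK.
by exists G; do 2![split=> //]; apply: submodule_kermx.
Qed.

(** An ideal of R / N R is generated by the class of a generator of its preimage. *)
Lemma principal_quotient_principal (R : idomainType) (N : R)
    (NU : N \isn't a GRing.unit) (I : principal_quotient NU -> Prop) :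
  is_pid R -> is_ideal I -> exists a, forall x, I x <-> exists r, x = r * a.
Proof.
move=> pidR [I0 ID IM].
pose pi : {rmorphism R -> principal_quotient NU} :=
  \pi_({ideal_quot (proper_principal_ideal NU)})%qT.
have [|a Ia] := pidR (fun r => I (pi r)).
  split=> [|x y Ix Iy|b x Ix]; first by rewrite rmorph0.
    by rewrite rmorphD; apply: ID.
  by rewrite rmorphM; apply: IM.
exists (pi a) => x; split=> [Ix|[r ->]]; last first.
  by apply/IM/Ia; exists 1; rewrite mul1r.
have /Ia[r xE] : I (pi (repr x)) by rewrite /= reprK.
by exists (pi r); rewrite -rmorphM -xE /= reprK.
Qed.

(** * Multivariate polynomials as polynomials in the last variable *)

Section LastVariable.
Variables (n : nat) (A : comNzRingType).
Local Notation widen := (widen_ord (leqnSn n)).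

Definition mpoly_of_poly : {poly {mpoly A[n]}} -> {mpoly A[n.+1]} :=
  horner_morph (fun p => mulrC 'X_ord_max (@mwiden n A p)).

HB.instance Definition _ := GRing.RMorphism.on mpoly_of_poly.

Let max_widen i : (ord_max == widen i) = false.
Proof. by rewrite -val_eqE /= gtn_eqF. Qed.

Lemma mpoly_of_polyX : mpoly_of_poly 'X = 'X_ord_max.
Proof. exact: horner_morphX. Qed.

Lemma mpoly_of_polyC p : mpoly_of_poly p%:P = mwiden p.
Proof. exact: horner_morphC. Qed.

Lemma muniX m : muni 'X_[m] =
  'X_[[multinom m (widen i) | i < n]] *: 'X^(m ord_max) :> {poly {mpoly A[n]}}.
Proof. by rewrite muniE msuppX big_seq1 mcoeffX eqxx scale1r. Qed.

Lemma muni_mwiden (p : {mpoly A[n]}) : muni (mwiden p) = p%:P.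
Proof.
elim/mpolyind: p => [|c m p _ _ IHp]; first by rewrite !raddf0.
rewrite mwidenD muniD IHp polyCD mwidenZ mwidenX muniZ muniX mnmwiden_ordmax expr0.
rewrite alg_polyC -mul_polyC -polyCM mul_mpolyC; congr ((_ *: _)%:P + _).
by congr 'X_[_]; apply/mnmP => i; rewrite mnmE mnmwiden_widen.
Qed.

Lemma mpoly_of_polyK : cancel mpoly_of_poly (@muni n A).
Proof.
elim/poly_ind => [|p c IHp]; first by rewrite !raddf0.
rewrite !rmorphD !rmorphM /= IHp mpoly_of_polyX mpoly_of_polyC muni_mwiden.
rewrite muniX mnm1E eqxx expr1 (_ : [multinom _ | _ < _] = 0%MM).
  by rewrite mpolyX0 scale1r.
by apply/mnmP => i; rewrite mnmE mnm1E mnm0E max_widen.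
Qed.

Lemma muniK : cancel (@muni n A) mpoly_of_poly.
Proof.
elim/mpolyind => [|c m p _ _ IHp]; first by rewrite !raddf0.
rewrite muniD raddfD /= IHp muniZ muniX -!mul_polyC !rmorphM /= !mpoly_of_polyC.
rewrite rmorphXn /= mpoly_of_polyX mwidenC mwidenX mpolyXn -mpolyXD mul_mpolyC.
congr (_ *: 'X_[_] + _); apply/mnmP => i; rewrite mnmDE mulmnE mnm1E.
have [i_lt_n|n_le_i] := ltnP i n.
  have -> : i = widen (Ordinal i_lt_n) by apply/val_inj.
  by rewrite mnmwiden_widen mnmE max_widen addn0.
have -> : i = ord_max by apply/val_inj/eqP; rewrite eqn_leq n_le_i -ltnS ltn_ord.
by rewrite mnmwiden_ordmax eqxx mul1n.
Qed.
End LastVariable.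

Lemma mpolyC0K (A : comNzRingType) : cancel (@mpolyC 0 A) (@mcoeff 0 A 0%MM).
Proof. by move=> c; rewrite mcoeffC eqxx mulr1. Qed.

Lemma mcoeff0K (A : comNzRingType) : cancel (@mcoeff 0 A 0%MM) (@mpolyC 0 A).
Proof.
move=> p; apply/mpolyP => m; have -> : m = 0%MM by apply/mnmP => -[].
by rewrite mcoeffC eqxx mulr1.
Qed.

Lemma syzygies_stabilize_mpoly (A : comNzRingType) n :
  syzygies_stabilize A 0 -> syzygies_stabilize {mpoly A[n]} n.
Proof.
move=> stabA; elim: n => [|n IHn].
  exact: (syzygies_stabilize_iso (@mpolyC0K A) (@mcoeff0K A) stabA).
exact: (syzygies_stabilize_iso (@mpoly_of_polyK n A) (@muniK n A)
  (syzygies_stabilize_poly IHn)).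
Qed.

(** Unrolling a coinductive resolution into a sequence of matrices, by dependent
choice: the state at step i is the current syzygy module with its resolution. *)
Lemma resolved_sequence (S : comNzRingType) (r : nat -> nat)
    (K : 'rV[S]_(r 0%N) -> Prop) :
  resolved (fun i => r i.+1) K ->
  exists D : forall i, 'M[S]_(r i.+1, r i),
    (forall v, K v <-> exists w, v = w *m D 0%N) /\
    forall i (v : 'rV_(r i.+1)),
      v *m D i = 0 <-> exists w : 'rV_(r i.+2), v = w *m D i.+1.
Proof.
move=> resK.
pose state i := {P : 'rV[S]_(r i) -> Prop | resolved (fun j => r (j + i).+1) P}.
have step i (P : state i) : {D : 'M[S]_(r i.+1, r i) |
    (forall v, sval P v <-> exists w, v = w *m D)
    /\ resolved (fun j => r (j + i.+1).+1) (fun w : 'rV_(r i.+1) => w *m D = 0)}.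
  apply: cid; case: P => P [G PG resG]; exists G; split=> //.
  by under eq_fun do rewrite addnS.
have resK0 : resolved (fun j => r (j + 0).+1) K by under eq_fun do rewrite addn0.
pose st := fix st i : state i :=
  if i is j.+1 then exist _ _ (svalP (step j (st j))).2 else exist _ K resK0.
exists (fun i => sval (step i (st i))); split=> [v|i v].
  exact: (svalP (step 0%N (st 0%N))).1.
exact: (svalP (step i.+1 (st i.+1))).1.
Qed.

(** * The resolution of a finitely generated module *)

Lemma finite_free_rV (S : comNzRingType) r : finite_free 'rV[S]_r.
Proof.
exists r, (fun i => delta_mx 0 i) => x; exists [ffun i => x 0 i]; split=> [|c ->].
  by rewrite {1}[x]row_sum_delta; apply: eq_bigr => i _; rewrite ffunE.
apply/ffunP => i; rewrite ffunE summxE (bigD1 i) //= big1 => [|j ji].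
  by rewrite !mxE !eqxx mulr1 addr0.
by rewrite !mxE eqxx eq_sym (negPf ji) mulr0.
Qed.

Section LinearCombinations.
Variables (S : comNzRingType) (M : lmodType S) (k : nat) (g : 'I_k -> M).

Definition lincomb (w : 'rV[S]_k) : M := \sum_i w 0 i *: g i.

Lemma lincomb_linear : linear lincomb.
Proof.
move=> a u v; rewrite /lincomb scaler_sumr -big_split; apply: eq_bigr => i _ /=.
by rewrite !mxE scalerDl scalerA.
Qed.

HB.instance Definition _ :=
  GRing.isLinear.Build S 'rV[S]_k M *:%R lincomb lincomb_linear.
End LinearCombinations.

Theorem theorem5p6 (R : idomainType) (hR : is_pid R)
    (N : R) (hN0 : N != 0) (hNU : N \isn't a GRing.unit) (n : nat)
    (M : lmodType {mpoly (principal_quotient hNU)[n]})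
    (hM : finitely_generated M) :
  exists (p : nat) (F : nat -> lmodType {mpoly (principal_quotient hNU)[n]}),
    [/\ (p <= n.+1)%N,
        forall i, (i <= p)%N -> finite_free (F i)
      & exists (d : forall i, {linear F (minn i.+1 p) -> F (minn i p)})
               (e : {linear F (minn 0 p) -> M}),
          exact_resolution (C := fun i => F (minn i p)) d e].
Proof.
pose S : comNzRingType := {mpoly (principal_quotient hNU)[n]}.
have [k [g gM]] := hM.
have stabS : syzygies_stabilize S n.
  apply/syzygies_stabilize_mpoly/syzygies_stabilize_principal => I.
  exact: principal_quotient_principal.
have [|s [s_n resK]] := stabS k (fun w => lincomb g w = 0).
  split=> [|a u v u0 v0]; first exact: linear0.
  by rewrite lincomb_linear u0 v0 scaler0 addr0.
pose p := n.+1; pose r i := if i is j.+1 then s j else k.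
pose t i := r (minn i p).
(* with ranks written through minn, the maps have the required types as they are *)
have tS : s = (fun i => t i.+1).
  apply/funext => i; rewrite /t minnSS /=.
  by have [//|ni] := leqP i n; rewrite s_n // ltnW.
rewrite tS in resK.
have [D [D0 exD]] := @resolved_sequence S t _ resK.
exists p, (fun i => 'rV[S]_(r i)); split=> //.
  by move=> i _; apply: finite_free_rV.
exists (fun i => mulmxr (D i)), (lincomb g); split.
- move=> m; have [c ->] := gM m; exists (\row_i c i).
  by apply: eq_bigr => i _; rewrite mxE.
- by move=> v; rewrite D0; split=> -[w]; exists w.
by move=> i v; rewrite exD; split=> -[w]; exists w.
Qed.
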